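(* Let $\mathcal{K} = \mathcal{K}^1\times \cdots \times \mathcal{K}^r$ be a product of $r$ closed convex cones. The minimal face $\mathcal{F}_{\min}^D$ of $\mathcal{K}$ that contains the feasible slacks of (D) can be found in no more than $1+ \sum_{i=1}^{r} \ell_{\text{poly}}(\mathcal{K}^i)$ facial reduction steps. That is, there is a possible run of the Generic Facial Reduction algorithm applied to (D) that terminates with $\mathcal{F}_{\min}^D$ and outputs at most $1+ \sum_{i=1}^{r} \ell_{\text{poly}}(\mathcal{K}^i)$ directions.
   Context: Let $\mathcal{K}\subseteq\mathbb{R}^n$ be a closed convex cone with dual cone $\mathcal{K}^*$, $\mathcal{A}:\mathbb{R}^n\to\mathbb{R}^m$ linear with adjoint $\mathcal{A}^*$, $b\in\mathbb{R}^m$, $c\in\mathbb{R}^n$. Problem (D) is $\sup\{\langle b,y\rangle : c-\mathcal{A}^*y\in\mathcal{K}\}$. The set of feasible slacks is $\mathcal{F}_D^s=\{c-\mathcal{A}^*y\in\mathcal{K} : y\in\mathbb{R}^m\}$, and $\mathcal{F}_{\min}^D$ is the minimal face of $\mathcal{K}$ containing $\mathcal{F}_D^s$ (with $\mathcal{F}_{\min}^D=\emptyset$ if (D) is infeasible). Generic Facial Reduction: (1) Set $\mathcal{F}_1=\mathcal{K}$, $i=1$. (2) Let $d_i\in\mathcal{F}_i^*\cap\ker\mathcal{A}$ be such that either (i) $d_i\notin\mathcal{F}_i^\perp$ and $\langle c,d_i\rangle=0$, or (ii) $\langle c,d_i\rangle<0$; if no such $d_i$ exists, set $\mathcal{F}_{\min}^D=\mathcal{F}_i$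 and stop. (3) If $\langle c,d_i\rangle<0$, set $\mathcal{F}_{\min}^D=\emptyset$ and stop. (4) If $\langle c,d_i\rangle=0$, set $\mathcal{F}_{i+1}=\mathcal{F}_i\cap\{d_i\}^\perp$, increase $i$ by one, and return to (2). The output is the set of all directions $d_1,\dots,d_\ell$ found (including a last one with $\langle c,d_\ell\rangle<0$, if any) together with $\mathcal{F}_{\min}^D$; each direction counts as one facial reduction step. Distance to polyhedrality: for a nonempty closed convex cone $\mathcal{C}$, $\ell_{\text{poly}}(\mathcal{C})$ is the length minus one of the longest strictly ascending chain of nonempty faces $\mathcal{F}_1\subsetneq\cdots\subsetneq\mathcal{F}_\ell$ of $\mathcal{C}$ (length $\ell$) such that $\mathcal{F}_1$ is polyhedral and $\mathcal{F}_j$ is not polyhedral for all $j>1$. *)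

(* Defs.v *)
From HB Require Import structures.
From mathcomp Require Import all_boot all_order all_algebra.
From mathcomp Require Import all_classical all_reals all_analysis.
Set Implicit Arguments.
Unset Strict Implicit.
Unset Printing Implicit Defensive.
Import Order.TTheory GRing.Theory Num.Theory.
Import numFieldNormedType.Exports.
Local Open Scope classical_set_scope.
Local Open Scope ring_scope.

(* Vectors of R^n are columns 'cV[R]_n with the standard inner product, so a
   linear map is a matrix A (acting by A *m x) and its adjoint is A^T. *)

Definition dotp (R : realType) (n : nat) (x y : 'cV[R]_n) : R :=
  \sum_(i < n) x i 0 * y i 0.

Definition closed_convex_cone (R : realType) (n : nat) (C : set 'cV[R]_n) :=
  [/\ C !=set0, closed C,
      convex_set (C : set (convex_lmodType 'cV[R]_n))
    & forall (a : R) x, 0 <= a -> C x -> C (a *: x)].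

Definition prod_cone (R : realType) (r : nat) (n : 'I_r -> nat)
    (K : forall i, set 'cV[R]_(n i)) : set 'cV[R]_(\sum_(i < r) n i) :=
  [set x | forall i, K i (submxcol x i)].

Definition dual_cone (R : realType) (n : nat) (F : set 'cV[R]_n) :
    set 'cV[R]_n :=
  [set s | forall x, F x -> 0 <= dotp s x].

Definition orth (R : realType) (n : nat) (F : set 'cV[R]_n) : set 'cV[R]_n :=
  [set s | forall x, F x -> dotp s x = 0].

(* The empty set counts as a face. *)
Definition face (R : realType) (n : nat) (C F : set 'cV[R]_n) : Prop :=
  [/\ convex_set (F : set (convex_lmodType 'cV[R]_n)), F `<=` C
    & forall x y (t : R), C x -> C y -> 0 < t < 1 ->
        F (t *: x + (1 - t) *: y) -> F x /\ F y].

Definition polyhedral (R : realType) (n : nat) (F : set 'cV[R]_n) : Prop :=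
  exists (k : nat) (B : 'M[R]_(k, n)) (h : 'cV[R]_k),
    F = [set x | forall i, (B *m x) i 0 <= h i 0].

(* A chain with l + 1 members. *)
Definition poly_chain (R : realType) (n l : nat) (C : set 'cV[R]_n)
    (F : 'I_l.+1 -> set 'cV[R]_n) : Prop :=
  [/\ forall j, face C (F j) /\ F j !=set0,
      forall i j : 'I_l.+1, (i < j)%N -> F i `<` F j,
      polyhedral (F ord0)
    & forall j, j != ord0 -> ~ polyhedral (F j)].

Definition is_lpoly (R : realType) (n : nat) (C : set 'cV[R]_n) (l : nat) :=
  (exists F : 'I_l.+1 -> set 'cV[R]_n, poly_chain C F) /\
  (forall l' (F : 'I_l'.+1 -> set 'cV[R]_n), poly_chain C F -> (l' <= l)%N).

(* The default value is never used on closed convex cones: see lpolyP. *)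
Definition lpoly (R : realType) (n : nat) (C : set 'cV[R]_n) : nat :=
  xget 0%N [set l | is_lpoly C l].

Definition slacks (R : realType) (m n : nat) (K : set 'cV[R]_n)
    (A : 'M[R]_(m, n)) (c : 'cV[R]_n) : set 'cV[R]_n :=
  [set s | K s /\ exists y : 'cV[R]_m, s = c - A^T *m y].

(* Intersection of all faces of K containing S; it is a face (min_face_face),
   and it is empty when S is (min_face0). *)
Definition min_face (R : realType) (n : nat) (K S : set 'cV[R]_n) :
    set 'cV[R]_n :=
  smallest (face K) S.

Definition reducing_direction (R : realType) (m n : nat) (A : 'M[R]_(m, n))
    (c : 'cV[R]_n) (F : set 'cV[R]_n) (d : 'cV[R]_n) : Prop :=
  [/\ dual_cone F d, A *m d = 0
    & (~ orth F d /\ dotp c d = 0) \/ dotp c d < 0].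

(* [facial_reduction A c F ds Fmin]: started from the face F, some run of the
   algorithm outputs the list ds of directions, in the order in which they are
   found, and the set Fmin. *)
Inductive facial_reduction (R : realType) (m n : nat) (A : 'M[R]_(m, n))
    (c : 'cV[R]_n) : set 'cV[R]_n -> seq 'cV[R]_n -> set 'cV[R]_n -> Prop :=
| FR_stop F :
    ~ (exists d, reducing_direction A c F d) ->
    facial_reduction A c F [::] F
| FR_infeasible F d :
    reducing_direction A c F d -> dotp c d < 0 ->
    facial_reduction A c F [:: d] set0
| FR_step F d ds Fmin :
    reducing_direction A c F d -> dotp c d = 0 ->
    facial_reduction A c (F `&` orth [set d]) ds Fmin ->
    facial_reduction A c F (d :: ds) Fmin.

Lemma convex_setE (R : realType) (n : nat) (C : set 'cV[R]_n) :
  convex_set (C : set (convex_lmodType 'cV[R]_n)) <->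
  forall x y (t : R), 0 < t < 1 -> C x -> C y -> C (t *: x + (1 - t) *: y).
Proof.
split=> [cC x y t /andP[t0 t1] Cx Cy|cC].
  have := cC x y (Itv01 (ltW t0) (ltW t1)).
  by rewrite !inE; exact.
apply/convex_setW => x y; rewrite !inE => Cx Cy k k0 k1.
by rewrite inE; apply: cC => //; apply/andP.
Qed.

Lemma min_face_face (R : realType) (n : nat) (K S : set 'cV[R]_n) :
  closed_convex_cone K -> S `<=` K -> face K (min_face K S).
Proof.
move=> [_ _ cK _] SK; split.
- apply/convex_setE => x y t t01 Sx Sy G [fG SG].
  have [/convex_setE cG _ _] := fG.
  by apply: cG => //; [apply: Sx | apply: Sy].
- by move=> x; apply; split=> //; split.
- move=> x y t Kx Ky t01 Fxy.
  by split=> G [fG SG]; have [_ _ /(_ x y t)] := fG;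
    case=> //; apply: Fxy.
Qed.

Lemma face_set0 (R : realType) (n : nat) (K : set 'cV[R]_n) : face K set0.
Proof. by split=> // x y t; rewrite in_set0. Qed.

Lemma min_face0 (R : realType) (n : nat) (K : set 'cV[R]_n) :
  min_face K set0 = set0.
Proof. exact/smallest_id/face_set0. Qed.

Lemma mulmx_trL (R : realType) (n : nat) (W : 'M[R]_n) (x : 'cV[R]_n) :
  (x^T <= W)%MS <-> (cokermx W)^T *m x = 0.
Proof.
rewrite submxE; split=> [/eqP h|h].
  by rewrite -[x]trmxK -trmx_mul h trmx0.
by apply/eqP; rewrite -[LHS]trmxK trmx_mul trmxK h trmx0.
Qed.

(* The span of any set of vectors has a basis made of members of that set. *)
Lemma span_basis (R : realType) (n : nat) (S : set 'cV[R]_n) :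
  exists (k : nat) (W : 'M[R]_(k, n)),
    (forall i, S (row i W)^T) /\ (forall x, S x -> (x^T <= W)%MS).
Proof.
pose P k := `[< exists W : 'M[R]_(k, n),
                  row_free W /\ forall i, S (row i W)^T >].
have P0 : exists k, P k.
  exists 0%N; apply/asboolP; exists 0; split; last by case.
  by rewrite /row_free mxrank0.
have Pn k : P k -> (k <= n)%N.
  by move=> /asboolP[W [/eqP Wk _]]; rewrite -[k]Wk; exact: rank_leq_col.
case: (ex_maxnP P0 Pn) => k /asboolP[W [Wfree WS]] kmax.
exists k, W; split=> // x Sx; apply: contrapT => xW.
have /kmax : P (1 + k)%N; last by rewrite ltnn.
apply/asboolP; exists (col_mx x^T W); split; last first.
  move=> i; rewrite -(splitK i); case: (fintype.split i) => j /=.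
    rewrite rowKu (_ : row j x^T = x^T) ?trmxK//.
    by rewrite [j]ord1; apply/rowP => q; rewrite !mxE.
  by rewrite rowKd.
have rW : \rank W = k by apply/eqP.
rewrite /row_free -addsmxE eqn_leq; apply/andP; split.
  by rewrite addsmxE rank_leq_row.
rewrite add1n -{1}rW; apply: rank_ltmx; apply/andP; split.
  exact: addsmxSr.
by rewrite addsmx_sub submx_refl andbT; apply/negP.
Qed.

Lemma face_cone (R : realType) (n : nat) (C F : set 'cV[R]_n) :
  closed_convex_cone C -> face C F -> F !=set0 ->
  [/\ F 0, forall (a : R) x, 0 <= a -> F x -> F (a *: x)
    & forall x y, F x -> F y -> F (x + y)].
Proof.
move=> [[c0 Cc0] _ _ Cz] [/convex_setE cF FC Fe] [f0 Ff0].
have half : 0 < (2^-1 : R) < 1.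
  by rewrite invr_gt0 ltr0n invf_lt1 ?ltr0n// ltr1n.
have C0 : C 0 by rewrite -(scale0r c0); apply: Cz.
have F0 : F 0.
  have Cf0 : C (2 *: f0) by apply: Cz (FC _ Ff0).
  have [] // := Fe _ _ _ Cf0 C0 half.
  by rewrite scaler0 addr0 scalerA mulVf ?scale1r// pnatr_eq0.
have Fz (a : R) x : 0 <= a -> F x -> F (a *: x).
  move=> a0 Fx; have [a1|a1] := leP a 1; last first.
    have h : 0 < a^-1 < 1.
      by rewrite invr_gt0 (lt_trans ltr01 a1) invf_lt1 // (lt_trans ltr01 a1).
    have [] // := Fe _ _ _ (Cz _ _ a0 (FC _ Fx)) C0 h.
    by rewrite scaler0 addr0 scalerA mulVf ?scale1r// gt_eqF// (lt_trans ltr01).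
  have [->|an0] := eqVneq a 0; first by rewrite scale0r.
  have [->|an1] := eqVneq a 1; first by rewrite scale1r.
  have := cF x 0 a; rewrite scaler0 addr0; apply=> //.
  by rewrite lt_neqAle eq_sym an0 a0 lt_neqAle an1.
split=> // x y Fx Fy.
have -> : x + y = 2 *: (2^-1 *: x + (1 - 2^-1) *: y).
  rewrite scalerDr !scalerA mulrBr mulfV ?pnatr_eq0// scale1r.
  by rewrite mulr1 (_ : 2 - 1 = 1 :> R) ?scale1r// addrK.
exact/Fz/cF.
Qed.

(* A face of C contains every point of C lying in its span. *)
Lemma face_span (R : realType) (n k : nat) (C F : set 'cV[R]_n)
    (W : 'M[R]_(k, n)) (x : 'cV[R]_n) :
  closed_convex_cone C -> face C F -> F !=set0 ->
  (forall i, F (row i W)^T) -> (x^T <= W)%MS -> C x -> F x.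
Proof.
move=> cC fF F0 WF /submxP[D xD] Cx.
have [F00 Fz FD] := face_cone cC fF F0.
have Fsum (I : finType) (g : I -> 'cV[R]_n) :
    (forall i, F (g i)) -> F (\sum_i g i).
  by move=> Fg; apply: (big_ind F) => // i _.
pose e i := (row i W)^T.
pose p := \sum_i Num.max (D 0 i) 0 *: e i.
pose q := \sum_i Num.max (- D 0 i) 0 *: e i.
have Fp : F p.
  by apply: Fsum => i; apply: Fz (WF i); rewrite le_max lexx orbT.
have Fq : F q.
  by apply: Fsum => i; apply: Fz (WF i); rewrite le_max lexx orbT.
have xq : x + q = p.
  rewrite -[x]trmxK xD mulmx_sum_row raddf_sum /q /p -big_split /=.
  apply: eq_bigr => i _; rewrite linearZ /= -scalerDl; congr (_ *: _).
  have [d0|d0] := leP 0 (D 0 i).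
    by rewrite (max_idPr _) ?addr0 ?(max_idPl _)// oppr_le0.
  by rewrite (max_idPl _) ?subrr ?(max_idPr _)// ?oppr_ge0 ltW.
have half : 0 < (2^-1 : R) < 1.
  by rewrite invr_gt0 ltr0n invf_lt1 ?ltr0n// ltr1n.
have [_ _ _ Cz] := cC; have [_ FC Fe] := fF.
have [] := Fe (2 *: x) (2 *: q) 2^-1 (Cz _ _ _ Cx) (Cz _ _ _ (FC _ Fq)) half.
- exact: ler0n.
- exact: ler0n.
- have hh : 1 - 2^-1 = 2^-1 :> R.
    by rewrite [X in X - _](splitr 1) mul1r addrK.
  by rewrite hh !scalerA mulVf ?pnatr_eq0// !scale1r xq.
move=> F2x _; rewrite -[x]scale1r -[1](@mulVf _ 2) ?pnatr_eq0// -scalerA.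
by apply: Fz => //; rewrite invr_ge0.
Qed.

Lemma poly_chain_bound (R : realType) (n l : nat) (C : set 'cV[R]_n)
    (F : 'I_l.+1 -> set 'cV[R]_n) :
  closed_convex_cone C -> poly_chain C F -> (l <= n)%N.
Proof.
move=> cC [fF lF _ _].
suff H j : (j <= l)%N -> exists k (W : 'M[R]_(k, n)),
    (forall i, F (inord j) (row i W)^T) /\ (j <= \rank W)%N.
  have [k [W [_ h]]] := H l (leqnn l).
  exact: leq_trans h (rank_leq_col _).
elim: j => [_|j IH jl].
  by exists 0%N, 0; split=> //; case.
have [k [W [WF jW]]] := IH (ltnW jl).
have [k' [V [VF Vspan]]] := span_basis (F (inord j.+1)).
exists k', V; split=> //; apply: leq_ltn_trans jW _; apply: rank_ltmx.
have /lF [sFF nFF] : ((inord j : 'I_l.+1) < (inord j.+1 : 'I_l.+1))%N.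
  by rewrite !inordK// ltnS ltnW.
apply/andP; split.
  apply/row_subP => i; rewrite -[row i W]trmxK.
  exact/Vspan/sFF/WF.
apply/negP => VW; apply: nFF => x Fx.
have [fj fj0] := fF (inord j); have [fj1 _] := fF (inord j.+1).
apply: (face_span cC fj fj0 WF); first exact: submx_trans (Vspan _ Fx) VW.
by have [_ FC _] := fj1; apply: FC.
Qed.

Lemma poly_chain0 (R : realType) (n : nat) (C : set 'cV[R]_n) :
  closed_convex_cone C ->
  exists F : 'I_1 -> set 'cV[R]_n, poly_chain C F.
Proof.
move=> cC; have [[c0 Cc0] _ /convex_setE Cc Cz] := cC.
have fC : face C C.
  by split=> //; exact/convex_setE.
have [C0 _ CD] := face_cone cC fC (ex_intro _ _ Cc0).
pose L := C `&` [set x | C (- x)].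
have LD x y : L x -> L y -> L (x + y).
  by move=> [? ?] [? ?]; split; [exact: CD|rewrite /= opprD; exact: CD].
have LN x : L x -> L (- x) by move=> [? ?]; split=> //=; rewrite opprK.
have LZ (a : R) x : L x -> L (a *: x).
  move=> Lx; have [a0|/ltW a0] := leP 0 a.
    by case: Lx => ? ?; split; [|rewrite /= -scalerN]; exact: Cz.
  rewrite -[a]opprK scaleNr -scalerN.
  by case: (LN _ Lx) => ? ?; split; [|rewrite /= -scalerN];
    apply: Cz => //; rewrite oppr_ge0.
have L0 : L 0 by split; rewrite /= ?oppr0.
exists (fun=> L); split; last 2 first.
- have [k [W [WL Lspan]]] := span_basis L.
  pose M := (cokermx <<W>>%MS)^T.
  have LM x : L x <-> M *m x = 0.
    split=> [/Lspan h|/mulmx_trL].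
      by apply/mulmx_trL; rewrite genmxE.
    rewrite genmxE => /submxP[D xD].
    rewrite -[x]trmxK xD mulmx_sum_row raddf_sum /=.
    apply: (big_ind L) => // i _; rewrite linearZ /=; exact: LZ.
  exists (n + n)%N, (col_mx M (- M)), 0.
  apply/seteqP; split=> x.
    by move=> /LM h i; rewrite mul_col_mx mulNmx h oppr0 col_mx0.
  move=> h; apply/LM; apply/colP => i; rewrite [RHS]mxE.
  apply/eqP; rewrite eq_le -[X in _ && X]oppr_le0.
  have := h (rshift n i); have := h (lshift n i).
  by rewrite mul_col_mx col_mxEu col_mxEd mulNmx !mxE => -> ->.
- by move=> j; rewrite [j]ord1 eqxx.
- move=> _; split; last by exists 0.
  split.
  + apply/convex_setE => x y t _ Lx Ly.
    exact/LD/LZ/Ly/LZ.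
  + by move=> x [].
  + have key x y (t : R) : C x -> C y -> 0 < t -> 0 <= 1 - t ->
        L (t *: x + (1 - t) *: y) -> L x.
      move=> Cx Cy t0 t1 [_ /= h]; split=> //=.
      have -> : - x = t^-1 *: (- (t *: x + (1 - t) *: y) + (1 - t) *: y).
        by rewrite opprD addrNK scalerN scalerA mulVf ?scale1r// gt_eqF.
      by apply: (Cz); [rewrite invr_ge0 ltW|apply: CD => //; exact: Cz].
    move=> x y t Cx Cy /andP[t0 t1] Lxy; split.
      by apply: key Lxy => //; rewrite subr_ge0 ltW.
    apply: (key y x (1 - t)) => //; rewrite ?subr_gt0//.
      by rewrite subKr ltW.
    by rewrite subKr addrC.
- by move=> i j; rewrite [i]ord1 [j]ord1.
Qed.

Lemma lpolyP (R : realType) (n : nat) (C : set 'cV[R]_n) :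
  closed_convex_cone C -> is_lpoly C (lpoly C).
Proof.
move=> cC; rewrite /lpoly; apply: (@xgetPex _ 0%N [set l | is_lpoly C l]).
pose P l := `[< exists F : 'I_l.+1 -> set 'cV[R]_n, poly_chain C F >].
have P0 : exists l, P l by exists 0%N; apply/asboolP/poly_chain0.
have Pn l : P l -> (l <= n)%N.
  by move=> /asboolP[F]; exact: poly_chain_bound.
case: (ex_maxnP P0 Pn) => l /asboolP Pl lmax.
by exists l; split=> // l' F cF; apply/lmax/asboolP; exists F.
Qed.

(* Main.v *)
Require Import Defs.
From mathcomp Require Import all_boot all_order all_algebra.
From mathcomp Require Import all_classical all_reals all_analysis.
From mathcomp Require Import ring lra.
Set Implicit Arguments.
Unset Strict Implicit.
Unset Printing Implicit Defensive.
Import Order.TTheory GRing.Theory Num.Theory.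
Import numFieldNormedType.Exports.
Local Open Scope classical_set_scope.
Local Open Scope ring_scope.

(* Write the current face as C ∩ Q, where the cone C constrains the
   non-polyhedral blocks and the polyhedral cone Q the other ones.  If no slack
   in Q lies in the relative interior of C, separating C from the polyhedron of
   affine slacks in Q yields a reducing direction that either certifies
   infeasibility or cuts a non-polyhedral block down to a proper face; the
   latter lowers the sum of the distances to polyhedrality.  Otherwise strong
   duality holds with a partially polyhedral Slater condition, so every
   inequality of Q that is tight on all the slacks has a dual certificate, and
   the sum of these certificates exposes the minimal face in a single step. *)

(** * Inner product and Farkas' lemma *)

Lemma dotpE (R : realType) (n : nat) (x y : 'cV[R]_n) :
  dotp x y = (x^T *m y) 0 0.
Proof. by rewrite mxE; apply: eq_bigr => i _; rewrite mxE. Qed.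

Lemma dotpC (R : realType) (n : nat) (x y : 'cV[R]_n) : dotp x y = dotp y x.
Proof. by apply: eq_bigr => i _; rewrite mulrC. Qed.

Lemma dotpDr (R : realType) (n : nat) (x y z : 'cV[R]_n) :
  dotp x (y + z) = dotp x y + dotp x z.
Proof. by rewrite !dotpE mulmxDr mxE. Qed.

Lemma dotpZr (R : realType) (n : nat) (a : R) (x y : 'cV[R]_n) :
  dotp x (a *: y) = a * dotp x y.
Proof. by rewrite !dotpE -scalemxAr mxE. Qed.

Lemma dotpDl (R : realType) (n : nat) (x y z : 'cV[R]_n) :
  dotp (x + y) z = dotp x z + dotp y z.
Proof. by rewrite !(dotpC _ z) dotpDr. Qed.

Lemma dotpZl (R : realType) (n : nat) (a : R) (x y : 'cV[R]_n) :
  dotp (a *: x) y = a * dotp x y.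
Proof. by rewrite !(dotpC _ y) dotpZr. Qed.

Lemma dotpNr (R : realType) (n : nat) (x y : 'cV[R]_n) :
  dotp x (- y) = - dotp x y.
Proof. by rewrite -scaleN1r dotpZr mulN1r. Qed.

Lemma dotpNl (R : realType) (n : nat) (x y : 'cV[R]_n) :
  dotp (- x) y = - dotp x y.
Proof. by rewrite !(dotpC _ y) dotpNr. Qed.

Lemma dotp0 (R : realType) (n : nat) (x : 'cV[R]_n) : dotp x 0 = 0.
Proof. by rewrite dotpE mulmx0 mxE. Qed.

Lemma dot0p (R : realType) (n : nat) (x : 'cV[R]_n) : dotp 0 x = 0.
Proof. by rewrite dotpC dotp0. Qed.

Lemma dotp_mulmxl (R : realType) (p q : nat) (M : 'M[R]_(p, q)) x y :
  dotp (M *m x) y = dotp x (M^T *m y).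
Proof. by rewrite !dotpE trmx_mul mulmxA. Qed.

Lemma dotp_col_mx (R : realType) (p q : nat) (a b : 'cV[R]_p)
    (x y : 'cV[R]_q) :
  dotp (col_mx a x) (col_mx b y) = dotp a b + dotp x y.
Proof. by rewrite !dotpE tr_col_mx mul_row_col mxE. Qed.

Lemma dotp_ge0 (R : realType) (p : nat) (x y : 'cV[R]_p) :
  (forall i, 0 <= x i 0) -> (forall i, 0 <= y i 0) -> 0 <= dotp x y.
Proof. by move=> x0 y0; apply: sumr_ge0 => i _; apply: mulr_ge0. Qed.

Lemma dotp_row (R : realType) (p q : nat) (G : 'M[R]_(p, q)) k z :
  dotp (row k G)^T z = (G *m z) k 0.
Proof. by rewrite dotpE trmxK -row_mul mxE. Qed.

Lemma dotp_suml (R : realType) (n : nat) (I : finType) (P : pred I)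
    (g : I -> 'cV[R]_n) x :
  dotp (\sum_(i | P i) g i) x = \sum_(i | P i) dotp (g i) x.
Proof.
apply: (big_morph (fun v => dotp v x)); last exact: dot0p.
by move=> u v; rewrite dotpDl.
Qed.

Lemma dotp_eq0 (R : realType) (n : nat) (f : 'cV[R]_n) :
  (forall z, 0 <= dotp f z) -> f = 0.
Proof.
move=> f0; apply/colP => i; rewrite mxE.
have e z : dotp f z = 0.
  by apply/eqP; rewrite eq_le f0 andbT -oppr_ge0 -dotpNr.
have := e (delta_mx i 0); rewrite /dotp (bigD1 i)//= big1 => [|j ji].
  by rewrite !mxE !eqxx mulr1 addr0.
by rewrite mxE (negPf ji) mulr0.
Qed.

(* Induction on the number of inequalities: if the last one, a, cannot be
   dropped, some x0 violates only a, and projecting along x0 onto the kernel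
   of a eliminates it. *)
Lemma farkas (R : realType) (p q : nat) (G : 'M[R]_(p, q)) (f : 'cV[R]_q) :
  (forall z, (forall i, 0 <= (G *m z) i 0) -> 0 <= dotp f z) ->
  exists2 l : 'cV[R]_p, (forall i, 0 <= l i 0) & f = G^T *m l.
Proof.
elim: p G f => [|p IH] G f Gf.
  exists 0; first by case.
  by rewrite mulmx0; apply: dotp_eq0 => z; apply: Gf; case.
rewrite -[p.+1]/(1 + p)%N in G Gf *.
rewrite -[G]vsubmxK in Gf *; move: (usubmx G) (dsubmx G) Gf => a' H.
have [a -> {a'}] : exists a, a' = a^T by exists a'^T; rewrite trmxK.
have colge0 m1 m2 (u : 'cV[R]_m1) (v : 'cV[R]_m2) :
    (forall i, 0 <= u i 0) -> (forall i, 0 <= v i 0) ->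
    forall i, 0 <= col_mx u v i 0.
  by move=> u0 v0 i; rewrite mxE; case: fintype.split.
move=> Gf.
have fP z : 0 <= dotp a z -> (forall i, 0 <= (H *m z) i 0) -> 0 <= dotp f z.
  move=> az Hz; apply: Gf; rewrite mul_col_mx; apply: colge0 => // i.
  by rewrite [i]ord1 -dotpE.
have [Hf|] := pselect (forall z, (forall i, 0 <= (H *m z) i 0) ->
                                 0 <= dotp f z).
  have [l l0 ->] := IH _ _ Hf.
  exists (col_mx 0 l); first by apply: colge0 => // i; rewrite mxE.
  by rewrite tr_col_mx mul_row_col mulmx0 add0r.
move=> /existsNP[x0 /not_implyP[Hx0 /negP]]; rewrite -ltNge => fx0.
have ax0 : dotp a x0 < 0.
  by rewrite ltNge; apply/negP => /fP/(_ Hx0); rewrite leNgt fx0.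
set al := dotp a x0 in ax0; set be := dotp f x0 in fx0.
have al0 : al != 0 by rewrite lt_eqF.
(* The matrix on the left is [H] composed with the projection along [x0] onto the kernel of [a]. *)
have H'z z : (H - al^-1 *: (H *m x0 *m a^T)) *m z =
    H *m (z - (dotp a z / al) *: x0).
  rewrite mulmxBl mulmxBr -scalemxAl -scalemxAr -[H *m x0 *m _ *m _]mulmxA.
  rewrite [a^T *m z]mx11_scalar -dotpE mul_mx_scalar scalerA mulrC.
  by rewrite mulrC.
have [z|l l0 fE] := IH (H - al^-1 *: (H *m x0 *m a^T))
                       (f - (be / al) *: a).
  move=> Hz; have -> : dotp (f - (be / al) *: a) z =
      dotp f (z - (dotp a z / al) *: x0).
    rewrite dotpDl dotpDr dotpNl dotpNr dotpZl dotpZr -/be.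
    by ring.
  apply: fP => [|i]; last by rewrite -H'z.
  by rewrite dotpDr dotpNr dotpZr -/al divfK// subrr.
(* The multiplier of [a] collects the projection terms. It is nonnegative because [al] and [be] are
   negative while [H *m x0] and [l] have nonnegative entries. *)
exists (col_mx (al^-1 * (be - dotp (H *m x0) l))%:M l).
  apply: colge0 => // i; rewrite [i]ord1 mxE eqxx mulr1n.
  rewrite nmulr_rge0 ?invr_lt0//.
  have := dotp_ge0 Hx0 l0; lra.
rewrite tr_col_mx trmxK mul_row_col mul_mx_scalar.
rewrite -[LHS](subrK ((be / al) *: a)) fE linearB/= linearZ/= mulmxBl.
rewrite trmx_mul trmxK -scalemxAl -[a *m _ *m _]mulmxA.
rewrite [(H *m x0)^T *m l]mx11_scalar -dotpE mul_mx_scalar mulrBr scalerBl.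
rewrite scalerA.
by rewrite [be / al]mulrC addrC addrCA addrC.
Qed.

(** * Separation and partially polyhedral duality *)

(* Induction on the dimension: a functional on the hyperplane of vectors with
   vanishing first coordinate is extended to the whole space by a supremum. *)
Lemma cone_separation (R : realType) (n : nat) (K : set 'cV[R]_n) :
  (forall x y, K x -> K y -> K (x + y)) ->
  (forall (a : R) x, 0 < a -> K x -> K (a *: x)) ->
  ~ K 0 -> K !=set0 ->
  exists2 d, dual_cone K d & exists2 x, K x & 0 < dotp d x.
Proof.
elim: n K => [|n IH] K KD KZ K0 [x Kx].
  by case: K0; rewrite (_ : 0 = x)//; apply/colP; case.
rewrite -[n.+1]/(1 + n)%N in K KD KZ K0 x Kx *.
pose hd (x : 'cV[R]_(1 + n)) : R := usubmx x 0 0.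
have hdD u v : hd (u + v) = hd u + hd v by rewrite /hd linearD mxE.
have hdZ a u : hd (a *: u) = a * hd u by rewrite /hd linearZ mxE.
have xE (u : 'cV[R]_(1 + n)) : u = col_mx (hd u)%:M (dsubmx u).
  by rewrite -[LHS]vsubmxK -mx11_scalar.
have dE g d u : dotp (col_mx g%:M d) u = g * hd u + dotp d (dsubmx u).
  rewrite {1}[u]xE dotp_col_mx; congr (_ + _).
  by rewrite dotpE tr_scalar_mx mul_scalar_mx !mxE eqxx !mulr1n.
have hdsep s : (forall u, K u -> 0 <= s * hd u) ->
    (exists2 u, K u & 0 < s * hd u) ->
    exists2 d, dual_cone K d & exists2 x, K x & 0 < dotp d x.
  move=> h [u Ku us]; exists (col_mx s%:M 0) => [v /h|].
    by rewrite dE dot0p addr0.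
  by exists u => //; rewrite dE dot0p addr0.
pose K' := [set v : 'cV[R]_n | K (col_mx 0 v)].
have K'P u : K u -> hd u = 0 -> K' (dsubmx u).
  by move=> Ku hu; move: Ku; rewrite {1}[u]xE hu raddf0.
have sep' : K' !=set0 ->
    exists2 d, dual_cone K' d & exists2 x, K' x & 0 < dotp d x.
  apply: IH => [u v|a u a0|]; rewrite /K' /=; last by rewrite col_mx0.
    by move=> /KD/[apply]; rewrite add_col_mx addr0.
  by move=> /(KZ _ _ a0); rewrite scale_col_mx scaler0.
have ext d : dual_cone K' d -> (exists2 v, K' v & 0 < dotp d v) ->
    (exists g, forall u, K u -> 0 <= g * hd u + dotp d (dsubmx u)) ->
    exists2 d, dual_cone K d & exists2 x, K x & 0 < dotp d x.
  move=> dK' [v K'v dv] [g gP]; exists (col_mx g%:M d) => [u Ku|].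
    by rewrite dE; exact: gP.
  exists (col_mx 0 v) => //; rewrite dE col_mxKd /hd col_mxKu mxE mulr0.
  by rewrite add0r.
have flat : (forall u, K u -> hd u = 0) ->
    exists2 d, dual_cone K d & exists2 x, K x & 0 < dotp d x.
  move=> h; have [|d dK' dpos] := sep'.
    by exists (dsubmx x); apply: K'P => //; apply: h.
  apply: (ext d) => //; exists 0 => u Ku; rewrite mul0r add0r.
  exact/dK'/K'P/h.
(* If the first coordinate does not take both signs on [K], then up to sign it separates by itself,
   or it vanishes on [K] and the induction hypothesis is enough. *)
have [[up Kup up0]|noup] := pselect (exists2 u, K u & 0 < hd u); last first.
  have le0 u : K u -> hd u <= 0.
    by move=> Ku; rewrite leNgt; apply/negP => hu; apply: noup; exists u.
  have [[um Kum um0]|nodn] := pselect (exists2 u, K u & hd u < 0).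
    apply: (hdsep (-1)) => [u /le0|]; first by rewrite mulN1r oppr_ge0.
    by exists um => //; rewrite mulN1r oppr_gt0.
  apply: flat => u Ku; apply/eqP; rewrite eq_le le0//= leNgt.
  by apply/negP => hu; apply: nodn; exists u.
have [[um Kum um0]|nodn] := pselect (exists2 u, K u & hd u < 0); last first.
  apply: (hdsep 1) => [u Ku|]; last by exists up => //; rewrite mul1r.
  by rewrite mul1r leNgt; apply/negP => hu; apply: nodn; exists u.
have comb u v : K u -> K v -> 0 < hd u -> hd v < 0 ->
    K' (dsubmx ((hd u)^-1 *: u + (- hd v)^-1 *: v)).
  move=> Ku Kv u0 v0; apply: K'P.
    by apply: KD; apply: KZ => //; rewrite invr_gt0// oppr_gt0.
  rewrite hdD !hdZ mulVf ?gt_eqF// invrN mulNr mulVf ?lt_eqF//.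
  by rewrite subrr.
have [|d dK' dpos] := sep'; first by eexists; exact: comb Kup Kum up0 um0.
apply: (ext d) => //.
(* Points with positive first coordinate bound the missing coefficient from below, and those with
   negative one bound it from above. Each pair is compatible because its combination in the
   hyperplane is in [K'], so the supremum of the lower bounds is admissible. *)
have le u v : K u -> K v -> 0 < hd u -> hd v < 0 ->
    - (dotp d (dsubmx u) / hd u) <= - (dotp d (dsubmx v) / hd v).
  move=> Ku Kv u0 v0; have h := dK' _ (comb _ _ Ku Kv u0 v0).
  rewrite linearD !linearZ /= dotpDr !dotpZr invrN in h.
  by rewrite mulNr ![_^-1 * _]mulrC in h; lra.
pose S := [set - (dotp d (dsubmx u) / hd u) | u in [set u | K u /\ 0 < hd u]].
have Sup v : K v -> hd v < 0 ->
    ubound S (- (dotp d (dsubmx v) / hd v)).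
  by move=> Kv v0 _ [u [Ku u0] <-]; apply: le.
have S0 : S !=set0 by eexists; exists up.
exists (sup S) => u Ku; have [u0|u0|u0] := ltgtP (hd u) 0.
- have /(ge_sup S0) := Sup _ Ku u0.
  by rewrite -mulNr ler_ndivlMr//; lra.
- have : - (dotp d (dsubmx u) / hd u) <= sup S.
    apply: ub_le_sup; last by exists u.
    by eexists; exact: Sup Kum um0.
  by rewrite -mulNr ler_pdivrMr//; lra.
- by rewrite u0 mulr0 add0r; apply: dK'; apply: K'P.
Qed.

Lemma farkas_mixed (R : realType) (p k q : nat) (G : 'M[R]_(p, q))
    (E : 'M[R]_(k, q)) (u f : 'cV[R]_q) :
  (forall z, 0 <= dotp u z -> (forall i, 0 <= (G *m z) i 0) -> E *m z = 0 ->
     0 <= dotp f z) ->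
  exists (sg : R) (l : 'cV[R]_p) (mu : 'cV[R]_k),
    [/\ 0 <= sg, forall i, 0 <= l i 0 &
        f = G^T *m l + E^T *m mu + sg *: u].
Proof.
move=> H.
(* Each equation is split into two opposite inequalities; the free multiplier [mu] is the difference
   of their multipliers. *)
have [z Hz|L L0 ->] := @farkas R _ _ (col_mx u^T (col_mx G (col_mx E (- E)))) f.
  have Gz i : 0 <= (G *m z) i 0.
    have := Hz (rshift _ (lshift _ i)).
    by rewrite !mul_col_mx col_mxEd col_mxEu.
  have uz : 0 <= dotp u z.
    by have := Hz (lshift _ 0); rewrite !mul_col_mx col_mxEu -dotpE.
  apply: H => //; apply/colP => i; rewrite [RHS]mxE.
  apply/eqP; rewrite eq_le -[X in X && _]oppr_ge0.
  have := Hz (rshift _ (rshift _ (rshift _ i))).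
  have := Hz (rshift _ (rshift _ (lshift _ i))).
  rewrite !mul_col_mx !col_mxEd col_mxEu mulNmx [(- _ : 'cV_k) i 0]mxE.
  by move=> -> ->.
rewrite -[L]vsubmxK in L0 *; move: (usubmx L) (dsubmx L) L0 => sg L1 L0.
rewrite -[L1]vsubmxK in L0 *; move: (usubmx L1) (dsubmx L1) L0 => l L2 L0.
rewrite -[L2]vsubmxK in L0 *; move: (usubmx L2) (dsubmx L2) L0 => m1 m2 L0.
exists (sg 0 0), l, (m1 - m2); split.
- by have := L0 (lshift _ 0); rewrite col_mxEu.
- by move=> i; have := L0 (rshift _ (lshift _ i)); rewrite col_mxEd col_mxEu.
- rewrite !tr_col_mx trmxK !mul_row_col {1}[sg]mx11_scalar mul_mx_scalar.
  by rewrite linearN /= mulNmx mulmxBr addrC.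
Qed.

Definition conic (R : realType) (n : nat) (C : set 'cV[R]_n) : Prop :=
  [/\ C 0, forall (a : R) x, 0 <= a -> C x -> C (a *: x)
    & forall x y, C x -> C y -> C (x + y)].

(* The dual description of the relative interior, as the points of C lying in
   no proper exposed face. *)
Definition qri (R : realType) (n : nat) (C : set 'cV[R]_n) : set 'cV[R]_n :=
  [set s | C s /\ forall d, dual_cone C d -> dotp d s = 0 -> orth C d].

(** The kernel of [M] is the linear span of [C], so membership in that span can enter a Farkas
    system as equations. *)
Lemma span_equations (R : realType) (n : nat) (C : set 'cV[R]_n) :
  exists (k : nat) (M : 'M[R]_(k, n)),
    (forall x, C x -> M *m x = 0) /\
    (forall d x, orth C d -> M *m x = 0 -> dotp d x = 0).
Proof.
have [k [W [WC CW]]] := Defs.span_basis C.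
exists n, (cokermx <<W>>%MS)^T; split=> [x Cx|d x dC].
  by apply/mulmx_trL; rewrite genmxE; exact: CW.
move=> /mulmx_trL; rewrite genmxE => /submxP[D xD].
rewrite -[x]trmxK xD trmx_mul dotpC dotp_mulmxl trmxK.
rewrite (_ : W *m d = 0) ?dotp0//; apply/colP => i.
by rewrite [RHS]mxE -dotp_row dotpC; apply: dC.
Qed.

(** The sum of a spanning family taken in [C] works: a functional nonnegative on [C] that vanishes
    at the sum vanishes at each term, hence on the span. *)
Lemma qri_neq0 (R : realType) (n : nat) (C : set 'cV[R]_n) :
  conic C -> qri C !=set0.
Proof.
move=> [C0 CZ CD]; have [k [W [WC CW]]] := Defs.span_basis C.
exists (\sum_i (row i W)^T); split; first exact: big_ind.
move=> d dC ds x /CW/submxP[D xD].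
rewrite -[x]trmxK xD trmx_mul dotpC dotp_mulmxl trmxK.
rewrite (_ : W *m d = 0) ?dotp0//; apply/colP => i.
have /psumr_eq0P E : \sum_j dotp (row j W)^T d = 0.
  by rewrite -dotp_suml dotpC.
by rewrite [RHS]mxE -dotp_row E// => j _; rewrite dotpC; exact: dC.
Qed.

Lemma qriD (R : realType) (n : nat) (C : set 'cV[R]_n) s x :
  conic C -> qri C s -> C x -> qri C (s + x).
Proof.
move=> [_ _ CD] [Cs sC] Cx; split=> [|d dC]; first exact: CD.
have := dC _ Cs; have := dC _ Cx; rewrite dotpDr => dx ds dsx.
by apply: sC => //; lra.
Qed.

Lemma qriZ (R : realType) (n : nat) (C : set 'cV[R]_n) (a : R) s :
  conic C -> 0 < a -> qri C s -> qri C (a *: s).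
Proof.
move=> [_ CZ _] a0 [Cs sC]; split=> [|d dC]; first exact: CZ (ltW a0) _.
by rewrite dotpZr => /eqP; rewrite mulf_eq0 gt_eqF//= => /eqP; exact: sC.
Qed.

(** The limit [t] to infinity, used to read off recession directions. *)
Lemma ge0_slope (R : realType) (a b : R) :
  (forall t, 0 < t -> 0 <= a + t * b) -> 0 <= b.
Proof.
move=> H; rewrite leNgt; apply/negP => b0.
have t0 : 0 < (`|a| + 1) / - b.
  by apply: divr_gt0; rewrite ?oppr_gt0// ltr_wpDl.
have := H _ t0; rewrite invrN mulrN mulNr divfK ?lt_eqF//.
by have := ler_norm a; lra.
Qed.

(** The limit [t] to 0, used to pass from strict to weak inequalities. *)
Lemma ge0_base (R : realType) (a b : R) :
  (forall t, 0 < t -> 0 <= a + t * b) -> 0 <= a.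
Proof.
move=> H; apply: (@ge0_slope _ b) => t t0.
have := H t^-1; rewrite invr_gt0 => /(_ t0).
by rewrite -(pmulr_rge0 _ t0) mulrDr mulrA mulfV ?gt_eqF// mul1r addrC.
Qed.

(** Only [C] is treated through its relative interior. Separating it from the image under [T] of a
    polyhedral set gives [d], and Farkas' lemma then supplies the multipliers of that polyhedral
    set. The final disjunction makes the certificate nontrivial. *)
Lemma partially_polyhedral_alternative (R : realType) (N p q : nat)
    (C : set 'cV[R]_N) (T : 'M[R]_(N, q)) (G : 'M[R]_(p, q)) (u : 'cV[R]_q) :
  conic C ->
  ~ (exists z, [/\ 0 < dotp u z, forall i, 0 <= (G *m z) i 0
                 & qri C (T *m z)]) ->
  exists (d : 'cV[R]_N) (l : 'cV[R]_p) (sg : R),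
    [/\ dual_cone C d, forall i, 0 <= l i 0, 0 <= sg,
        T^T *m d + G^T *m l + sg *: u = 0 & 0 < sg \/ ~ orth C d].
Proof.
move=> cC noz; have [C0 CZ CD] := cC.
have [k [M [CM spanM]]] := span_equations C.
have oM mu : orth C (M^T *m mu).
  by move=> x /CM Mx; rewrite dotp_mulmxl trmxK Mx dotp0.
pose P z := [/\ 0 < dotp u z, forall i, 0 <= (G *m z) i 0 & M *m (T *m z) = 0].
(* If [P] is empty, the linear system is already inconsistent: Farkas' lemma for [- u] gives [u] the
   positive weight [1 + sg], with a [d] that vanishes on [C]. *)
have [[z1 Pz1]|noP] := pselect (exists z, P z); last first.
  have [z uz Gz Ez|sg [l [mu [sg0 l0 uE]]]] :=
      @farkas_mixed R _ _ _ G (M *m T) u (- u).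
    rewrite dotpNl oppr_ge0 leNgt; apply/negP => uz'; apply: noP.
    by exists z; split=> //; rewrite mulmxA.
  exists (M^T *m mu), l, (1 + sg); split=> //.
  - by move=> x Cx; rewrite oM.
  - by rewrite addr_ge0.
  - rewrite mulmxA -trmx_mul scalerDl scale1r [u + _]addrC addrA.
    by rewrite [_ + G^T *m l]addrC -uE addNr.
  - by left; rewrite ltr_wpDr.
have PD z w : P z -> P w -> P (z + w).
  move=> [uz Gz Mz] [uw Gw Mw]; split; first by rewrite dotpDr addr_gt0.
  - by move=> i; rewrite mulmxDr mxE addr_ge0.
  - by rewrite !mulmxDr Mz Mw addr0.
have PZ a z : 0 < a -> P z -> P (a *: z).
  move=> a0 [uz Gz Mz]; split; first by rewrite dotpZr mulr_gt0.
  - by move=> i; rewrite -scalemxAr mxE mulr_ge0// ltW.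
  - by rewrite -!scalemxAr Mz scaler0.
pose K := [set x | exists r z, [/\ qri C r, P z & x = r - T *m z]].
have [s1 ris1] := qri_neq0 cC.
have [x y|a x a0|||d dK [_ [r [z [rir Pz ->]]] dpos]] := @cone_separation R _ K.
- move=> [r [z [rir Pz ->]]] [r' [z' [[Cr' _] Pz' ->]]].
  exists (r + r'), (z + z'); split; [exact: qriD|exact: PD|].
  by rewrite mulmxDr opprD addrACA.
- move=> [r [z [rir Pz ->]]]; exists (a *: r), (a *: z).
  by split; [exact: qriZ|exact: PZ|rewrite scalerBr scalemxAr].
- move=> [r [z [rir [uz Gz Mz] /eqP]]]; rewrite eq_sym subr_eq0 => /eqP rE.
  by apply: noz; exists z; split=> //; rewrite -rE.
- by exists (s1 - T *m z1), s1, z1.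
have dKE r' z' : qri C r' -> P z' -> 0 <= dotp d r' - dotp d (T *m z').
  by move=> rir' Pz'; rewrite -dotpNr -dotpDr; apply: dK; exists r', z'.
have dC : dual_cone C d.
  move=> x Cx; apply: (@ge0_slope _ (dotp d s1 - dotp d (T *m z1))) => t t0.
  have /dKE/(_ Pz1) : qri C (s1 + t *: x) by apply: qriD => //; exact/CZ/Cx/ltW.
  by rewrite dotpDr dotpZr addrAC.
have dP w : P w -> dotp d (T *m w) <= 0.
  move=> Pw; rewrite -oppr_ge0; apply: (@ge0_slope _ (dotp d s1)) => t t0.
  have := dKE _ _ ris1 (PZ _ _ t0 Pw).
  by rewrite -scalemxAr dotpZr mulrN.
(* Otherwise [d] would vanish on the span of [C], which contains both [r] and [T *m z], against the
   properness of the separation. *)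
have doC : ~ orth C d.
  move=> oC; have [Cr _] := rir; have [_ _ Mz] := Pz.
  by move: dpos; rewrite dotpDr dotpNr oC// spanM// subrr ltxx.
have [w uw Gw Ew|sg [l [mu [sg0 l0 uE]]]] :=
    @farkas_mixed R _ _ _ G (M *m T) u (- (T^T *m d)).
  rewrite dotpNl oppr_ge0 dotp_mulmxl trmxK -oppr_ge0.
  (* Here [w] satisfies only the weak inequality for [u], but [w + t *: z1] is in [P] for all
     [t > 0]. *)
  apply: (@ge0_base _ _ (- dotp d (T *m z1))) => t t0.
  rewrite mulrN -opprD oppr_ge0 -dotpZr -dotpDr scalemxAr -mulmxDr; apply: dP.
  have [uz1 Gz1 Mz1] := Pz1; split.
  - by rewrite dotpDr dotpZr ltr_wpDl// mulr_gt0.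
  - by move=> i; rewrite mulmxDr -scalemxAr mxE addr_ge0// mxE mulr_ge0// ltW.
  - by rewrite !mulmxDr -!scalemxAr mulmxA Ew Mz1 scaler0 addr0.
exists (d + M^T *m mu), l, sg; split=> //.
- by move=> x Cx; rewrite dotpDl oM// addr0; exact: dC.
- rewrite mulmxDr mulmxA -trmx_mul -addrA -addrA [X in _ + X]addrA.
  by rewrite [_ + G^T *m l]addrC -uE addrN.
- right=> oC; apply: doC => x Cx.
  by have := oC _ Cx; rewrite dotpDl oM// addr0.
Qed.

(* The alternative is applied to the objective f in the role of u, with u >= 0
   moved to the polyhedral inequalities. *)
Lemma partially_polyhedral_duality (R : realType) (N p q : nat)
    (C : set 'cV[R]_N) (T : 'M[R]_(N, q)) (G : 'M[R]_(p, q)) (u f : 'cV[R]_q) :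
  conic C ->
  (exists z, [/\ 0 < dotp u z, forall i, 0 <= (G *m z) i 0
               & qri C (T *m z)]) ->
  (forall z, 0 < dotp u z -> (forall i, 0 <= (G *m z) i 0) -> C (T *m z) ->
     dotp f z <= 0) ->
  exists (d : 'cV[R]_N) (l : 'cV[R]_p) (sg : R),
    [/\ dual_cone C d, forall i, 0 <= l i 0, 0 <= sg &
        T^T *m d + G^T *m l + sg *: u + f = 0].
Proof.
move=> cC [z0 [uz0 Gz0 riz0]] fle; have [_ CZ CD] := cC.
have [Cz0 _] := riz0.
have colge0 (v : 'cV[R]_q) w : (forall i, 0 <= (col_mx v^T G *m w) i 0) ->
    0 <= dotp v w /\ (forall i, 0 <= (G *m w) i 0).
  move=> h; split=> [|i].
    by have := h (lshift _ 0); rewrite mul_col_mx col_mxEu -dotpE.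
  by have := h (rshift _ i); rewrite mul_col_mx col_mxEd.
have [[z [fz /colge0[uz Gz] [Cz _]]]|d [L [sg [dC L0 sg0 E nz]]]] :=
    @partially_polyhedral_alternative R _ _ _ C T (col_mx u^T G) f cC.
  have : dotp f z <= 0.
    rewrite -oppr_ge0; apply: (@ge0_base _ _ (- dotp f z0)) => t t0.
    rewrite mulrN -opprD oppr_ge0 -dotpZr -dotpDr; apply: fle.
    - by rewrite dotpDr dotpZr ltr_wpDl// mulr_gt0.
    - by move=> i; rewrite mulmxDr -scalemxAr mxE addr_ge0// mxE mulr_ge0// ltW.
    - by rewrite mulmxDr -scalemxAr; apply: CD => //; exact/CZ/Cz0/ltW.
  by rewrite leNgt fz.
rewrite -[L]vsubmxK in L0 E; move: (usubmx L) (dsubmx L) L0 E => s l L0.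
rewrite tr_col_mx trmxK mul_row_col [s]mx11_scalar mul_mx_scalar => E.
have s0 : 0 <= s 0 0 by have := L0 (lshift _ 0); rewrite col_mxEu.
have l0 i : 0 <= l i 0 by have := L0 (rshift _ i); rewrite col_mxEd.
(* If [sg] were 0, pairing [E] with the Slater point [z0] would make a sum of nonnegative terms
   vanish. Then [d] would vanish at a relatively interior point, hence on [C], which the alternative
   excludes. *)
have sgp : 0 < sg.
  case: nz => // noC; rewrite lt_neqAle sg0 andbT eq_sym.
  apply/negP => /eqP sgE; apply: noC.
  apply: (riz0.2) => //; have := congr1 (fun v => dotp v z0) E; rewrite /=.
  rewrite sgE scale0r addr0 !dotpDl dot0p dotpZl !dotp_mulmxl !trmxK.
  have := dC _ Cz0; have := dotp_ge0 l0 Gz0.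
  by have := mulr_ge0 s0 (ltW uz0); lra.
have sgV : 0 <= sg^-1 by rewrite invr_ge0.
exists (sg^-1 *: d), (sg^-1 *: l), (sg^-1 * s 0 0); split.
- by move=> x Cx; rewrite dotpZl mulr_ge0//; exact: dC.
- by move=> i; rewrite mxE mulr_ge0.
- by rewrite mulr_ge0.
- rewrite -!scalemxAr -scalerA -[f]scale1r -[1](@mulVf _ sg) ?gt_eqF//.
  rewrite -scalerA -!scalerDr -[X in _ *: (X + _)]addrA [G^T *m l + _]addrC.
  by rewrite E scaler0.
Qed.

(** The geometric side of [qri]: segments of [C] ending at [s] can be prolonged. If not, 0 is
    separated from [C] plus positive multiples of [x] plus the line of [s]; the separating
    functional is nonnegative on [C] and zero at [s], hence zero on [C], so the separation is not
    proper. *)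
Lemma qri_prolongation (R : realType) (n : nat) (C : set 'cV[R]_n) s x :
  conic C -> qri C s -> C x -> exists2 e : R, 0 < e & C (s - e *: x).
Proof.
move=> cC [Cs sC] Cx; have [C0 CZ CD] := cC.
apply: contrapT => noe.
pose K := [set y | exists (a t : R) c,
  [/\ 0 < t, C c & y = c + t *: x - a *: s]].
have [y z|b y b0|||d dK [_ [a [t [c [t0 Cc ->]]]]]] := @cone_separation R _ K.
- move=> [a [t [c [t0 Cc ->]]]] [a' [t' [c' [t'0 Cc' ->]]]].
  exists (a + a'), (t + t'), (c + c'); split; rewrite ?addr_gt0//.
    exact: CD.
  by rewrite !scalerDl opprD addrACA; congr (_ + _); rewrite addrACA.
- move=> [a [t [c [t0 Cc ->]]]]; exists (b * a), (b * t), (b *: c).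
  by split; rewrite ?mulr_gt0// ?scalerBr ?scalerDr ?scalerA//; exact/CZ/Cc/ltW.
- move=> [a [t [c [t0 Cc /eqP]]]]; rewrite eq_sym subr_eq0 => /eqP E.
  (* The coefficient [a] may have any sign; adding a multiple of [s] replaces it by a positive [a'],
     by which one can divide. *)
  apply: noe; pose a' := `|a| + 1.
  have a'0 : 0 < a' by rewrite ltr_wpDl.
  exists (t / a'); first exact: divr_gt0.
  have -> : s - (t / a') *: x = a'^-1 *: (c + (a' - a) *: s).
    rewrite scalerBl -E opprD addrCA addNKr scalerBr !scalerA.
    by rewrite mulVf ?gt_eqF// scale1r mulrC.
  apply: (CZ); first by rewrite invr_ge0 ltW.
  apply: CD => //; apply: CZ => //.
  by have := ler_norm a; rewrite /a'; lra.
- by exists x, 0, 1, 0; split=> //; rewrite scale1r add0r scale0r subr0.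
have dE a' t' c' : 0 < t' -> C c' ->
    0 <= dotp d c' + t' * dotp d x - a' * dotp d s.
  move=> t'0 Cc'; rewrite -!dotpZr -dotpDr -dotpNr -dotpDr.
  by apply: dK; exists a', t', c'.
have dC : dual_cone C d.
  move=> y Cy; apply: (@ge0_slope _ (dotp d x)) => b b0.
  have := dE 0 1 (b *: y) ltr01 (CZ _ _ (ltW b0) Cy).
  by rewrite dotpZr mul1r mul0r subr0 addrC.
have ds : dotp d s = 0.
  apply/eqP; rewrite eq_le dC// andbT -oppr_ge0.
  apply: (@ge0_slope _ (dotp d x)) => b b0.
  by have := dE b 1 0 ltr01 C0; rewrite dotp0 add0r mul1r mulrN.
rewrite dotpDr dotpDr dotpNr !dotpZr.
by rewrite !(sC d dC ds)// !mulr0 addr0 subr0 ltxx.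
Qed.

(** * Faces, distance to polyhedrality and products *)

Lemma closed_convex_cone_conic (R : realType) (n : nat) (C : set 'cV[R]_n) :
  closed_convex_cone C -> conic C.
Proof.
move=> cC; have [C0 _ cvx _] := cC.
by apply: (face_cone cC) => //; split.
Qed.

Lemma face_trans (R : realType) (n : nat) (C F G : set 'cV[R]_n) :
  face C F -> face F G -> face C G.
Proof.
move=> [_ FC Fe] [cG GF Ge]; split=> // [x /GF/FC //|x y t Cx Cy t01 Gxy].
have [Fx Fy] := Fe _ _ _ Cx Cy t01 (GF _ Gxy).
exact: Ge Gxy.
Qed.

Lemma face_subset (R : realType) (n : nat) (C F G : set 'cV[R]_n) :
  F `<=` C -> face C G -> G `<=` F -> face F G.
Proof.
move=> FC [cG _ Ge] GF; split=> // x y t Fx Fy t01.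
by apply: Ge => //; exact: FC.
Qed.

Lemma face_setI (R : realType) (n : nat) (C F G : set 'cV[R]_n) :
  face C F -> face C G -> face C (F `&` G).
Proof.
move=> [/convex_setE cF FC Fe] [/convex_setE cG _ Ge]; split.
- apply/convex_setE => x y t t01 [Fx Gx] [Fy Gy].
  by split; [exact: cF|exact: cG].
- by move=> x [/FC].
- move=> x y t Cx Cy t01 [Fxy Gxy].
  have [Fx Fy] := Fe _ _ _ Cx Cy t01 Fxy.
  by have [Gx Gy] := Ge _ _ _ Cx Cy t01 Gxy.
Qed.

(** A run continued inside a smaller face thus still ends at the minimal face of the initial
    cone. *)
Lemma min_face_of_face (R : realType) (n : nat) (F H S : set 'cV[R]_n) :
  face F H -> S `<=` H -> min_face H S = min_face F S.
Proof.
move=> fH SH; have [_ HF _] := fH; apply/seteqP; split=> x xS G [fG SG].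
  have [] // : (H `&` G) x; apply: xS; split; last by move=> y Sy; split; auto.
  by apply: (face_subset HF); [exact: face_setI|move=> y []].
by apply: xS; split=> //; exact: face_trans fH fG.
Qed.

Lemma hyperplane_closed (R : realType) (n : nat) (d : 'cV[R]_n) :
  closed (orth [set d]).
Proof.
have -> : orth [set d] = (fun x => dotp x d) @^-1` [set 0].
  by apply/seteqP; split=> x /= => [xd|xd _ ->//]; exact: xd.
apply: preimage_closed; last exact: closed_eq.
have cM i : continuous (fun x : 'cV[R]_n => x i 0 * d i 0).
  move=> x; apply: (@continuousM _ _ (fun x : 'cV[R]_n => x i 0)).
    exact: coord_continuous.
  exact: cst_continuous.
move=> x _; apply: (@continuous_big _ _ +%R 0 xpredT).
  exact: add_continuous.
by move=> i _; exact: cM.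
Qed.

Lemma exposed_face (R : realType) (n : nat) (F : set 'cV[R]_n) (d : 'cV[R]_n) :
  conic F -> dual_cone F d -> face F (F `&` orth [set d]).
Proof.
move=> [_ FZ FD] dF; split.
- apply/convex_setE => x y t /andP[t0 t1] [Fx xd] [Fy yd]; split.
    by apply: FD; apply: FZ; rewrite ?subr_ge0// ltW.
  by move=> _ ->; rewrite dotpDl !dotpZl (xd d)// (yd d)// !mulr0 addr0.
- by move=> x [].
- move=> x y t Fx Fy /andP[t0 t1] [_ /(_ d erefl)].
  have := dF _ Fx; have := dF _ Fy.
  rewrite dotpDl !dotpZl ![dotp d _]dotpC => yd xd E.
  suff [xd0 yd0] : dotp x d = 0 /\ dotp y d = 0.
    by split; split=> // _ ->.
  by split; nra.
Qed.

Lemma exposed_face_closed_convex_cone (R : realType) (n : nat)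
    (F : set 'cV[R]_n) (d : 'cV[R]_n) :
  closed_convex_cone F -> dual_cone F d ->
  closed_convex_cone (F `&` orth [set d]).
Proof.
move=> cF dF; have kF := closed_convex_cone_conic cF.
have [cvx _ _] := exposed_face kF dF.
have [F0 _ _] := kF; have [_ clF _ FZ] := cF.
split=> //.
- by exists 0; split=> // x _; rewrite dot0p.
- by apply: closedI => //; exact: hyperplane_closed.
- move=> a x a0 [Fx xd]; split; first exact: FZ.
  by move=> _ ->; rewrite dotpZl xd// mulr0.
Qed.

Lemma lpoly_face (R : realType) (n : nat) (C F : set 'cV[R]_n) :
  closed_convex_cone C -> closed_convex_cone F -> face C F ->
  (lpoly F <= lpoly C)%N.
Proof.
move=> /lpolyP[_ Cmax] /lpolyP[[H [fH ltH H0 Hn]] _] fF; apply: (Cmax _ H).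
by split=> // j; have [? ?] := fH j; split=> //; exact: face_trans fF _.
Qed.

(** A longest chain of [F] is extended by [C] itself as its new top member. *)
Lemma lpoly_proper_face (R : realType) (n : nat) (C F : set 'cV[R]_n) :
  closed_convex_cone C -> closed_convex_cone F -> face C F ->
  ~ polyhedral C -> ~ C `<=` F -> (lpoly F < lpoly C)%N.
Proof.
move=> cC /lpolyP[[H [fH ltH H0 Hn]] _] fF nC CF.
have [_ FC _] := fF; have [_ Cmax] := lpolyP cC.
set l := lpoly F in H fH ltH H0 Hn *.
pose H' (j : 'I_l.+2) := if (j < l.+1)%N then H (inord j) else C.
have fC : face C C by have [_ _ cvx _] := cC; split.
apply: (Cmax _ H'); split.
- move=> j; rewrite /H'; case: ifP => _; last by have [C0 _ _ _] := cC.
  by have [? ?] := fH (inord j); split=> //; exact: face_trans fF _.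
- move=> i j ij; rewrite /H'; case: ifP => il; last first.
    by rewrite (leq_trans ij)// -ltnS in il.
  case: ifP => jl; first by apply: ltH; rewrite !inordK.
  have [[_ HF _] _] := fH (inord i).
  by split=> [x /HF/FC //|CH]; apply: CF => x /CH/HF.
- by rewrite /H' /= (_ : inord 0 = ord0)//; apply: val_inj; rewrite /= inordK.
- move=> j j0; rewrite /H'; case: ifP => jl; last by [].
  apply: Hn; apply: contra_neq j0 => /(congr1 val) /=.
  by rewrite inordK// => j0; exact: val_inj.
Qed.

(** The right-hand side [h] is nonnegative because 0 is in [F], and scaling a point by large factors
    shows that [h] can be replaced by 0. *)
Lemma polyhedral_cone (R : realType) (n : nat) (F : set 'cV[R]_n) :
  conic F -> polyhedral F ->
  exists (k : nat) (B : 'M[R]_(k, n)),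
    forall x, F x <-> (forall i, 0 <= (B *m x) i 0).
Proof.
move=> [F0 FZ _] [k [B [h FE]]].
have h0 i : 0 <= h i 0.
  by move: F0; rewrite FE => /(_ i); rewrite mulmx0 mxE.
exists k, (- B) => x; split=> [Fx i|Bx].
  rewrite mulNmx mxE; apply: (@ge0_slope _ (h i 0)) => t t0.
  have := FZ _ _ (ltW t0) Fx; rewrite FE => /(_ i).
  by rewrite -scalemxAr mxE mulrN subr_ge0.
rewrite FE => i; apply: le_trans (h0 i).
by have := Bx i; rewrite mulNmx mxE oppr_ge0.
Qed.

Lemma dotp_blocks (R : realType) (r : nat) (n : 'I_r -> nat)
    (x y : 'cV[R]_(\sum_(i < r) n i)) :
  dotp x y = \sum_i dotp (submxcol x i) (submxcol y i).
Proof.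
rewrite dotpE -[x in LHS]submxcolK -[y in LHS]submxcolK tr_mxcol.
rewrite mul_mxrow_mxcol summxE; apply: eq_bigr => i _.
by rewrite dotpE.
Qed.

Lemma block_vector (R : realType) (r : nat) (n : 'I_r -> nat) (i : 'I_r)
    (x : 'cV[R]_(n i)) :
  exists y : 'cV[R]_(\sum_(i < r) n i), submxcol y i = x /\
    forall j, j != i -> submxcol y j = 0.
Proof.
(* The type of block [j] is not syntactically that of [x]; [conform_mx] returns [x] once the
   dimensions agree. *)
exists (\mxcol_j (if i == j then conform_mx 0 x else 0)).
split=> [|j ji]; rewrite mxcolK ?eqxx ?conform_mx_id//.
by rewrite eq_sym (negPf ji).
Qed.

Lemma dual_prod_cone (R : realType) (r : nat) (n : 'I_r -> nat)
    (F : forall i, set 'cV[R]_(n i)) d :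
  (forall i, F i 0) -> dual_cone (prod_cone F) d ->
  forall i, dual_cone (F i) (submxcol d i).
Proof.
move=> F0 dF i x Fx; have [y [yi yj]] := block_vector x.
have : 0 <= dotp d y.
  by apply: dF => j; have [->|/yj ->//] := eqVneq j i; rewrite yi.
rewrite dotp_blocks (bigD1 i)//= yi big1 ?addr0// => j /yj ->.
by rewrite dotp0.
Qed.

(** Every block of [d] is nonnegative on its factor, so the sum over the blocks vanishes only if
    each term does. *)
Lemma prod_cone_exposed_face (R : realType) (r : nat) (n : 'I_r -> nat)
    (F : forall i, set 'cV[R]_(n i)) d :
  (forall i, F i 0) -> dual_cone (prod_cone F) d ->
  prod_cone F `&` orth [set d] =
  prod_cone (fun i => F i `&` orth [set submxcol d i]).
Proof.
move=> F0 dF; have di := dual_prod_cone F0 dF.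
apply/seteqP; split=> x.
  move=> [Fx /(_ d erefl)]; rewrite dotp_blocks => /psumr_eq0P E i.
  split; first exact: Fx.
  by move=> _ ->; apply: E => // j _; rewrite dotpC; exact/di/Fx.
move=> Fx; split=> [i|_ ->]; first by have [] := Fx i.
by rewrite dotp_blocks big1// => i _; have [_ ->] := Fx i.
Qed.

(** * Facial reduction *)

(* Homogenized slacks: (y, t) is sent to t c - A^T y; [level] reads off t. *)
Definition slack_mx (R : realType) (m n : nat) (A : 'M[R]_(m, n))
    (c : 'cV[R]_n) : 'M[R]_(n, m + 1) := row_mx (- A^T) c.

Definition level (R : realType) (m : nat) : 'cV[R]_(m + 1) := col_mx 0 1%:M.

Lemma slack_mx_affine (R : realType) (m n : nat) (A : 'M[R]_(m, n)) c y :
  slack_mx A c *m col_mx y 1%:M = c - A^T *m y.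
Proof. by rewrite mul_row_col mulmx1 mulNmx addrC. Qed.

Lemma level_affine (R : realType) (m : nat) (y : 'cV[R]_m) :
  dotp (level R m) (col_mx y 1%:M) = 1.
Proof. by rewrite dotp_col_mx dot0p add0r dotpE trmx1 mul1mx mxE. Qed.

Lemma slack_mx_level (R : realType) (m n : nat) (A : 'M[R]_(m, n)) c z :
  0 < dotp (level R m) z ->
  exists y, slack_mx A c *m z = dotp (level R m) z *: (c - A^T *m y).
Proof.
rewrite -[z]vsubmxK; move: (usubmx z) (dsubmx z) => y t.
rewrite dotp_col_mx dot0p add0r dotpE trmx1 mul1mx => t0.
exists ((t 0 0)^-1 *: y); rewrite mul_row_col {1}[t]mx11_scalar mul_mx_scalar.
by rewrite scalerBr -scalemxAr scalerA mulfV ?gt_eqF// scale1r mulNmx addrC.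
Qed.

(** Translates a homogenized certificate: a positive [sg] makes [g] negative on [c], and a zero [sg]
    makes it orthogonal to [c]. *)
Lemma slack_mx_tr (R : realType) (m n : nat) (A : 'M[R]_(m, n)) c g (sg : R) :
  (slack_mx A c)^T *m g + sg *: level R m = 0 ->
  A *m g = 0 /\ dotp c g = - sg.
Proof.
rewrite tr_row_mx linearN /= trmxK mul_col_mx scale_col_mx add_col_mx.
rewrite scaler0 addr0 -[X in _ = X]col_mx0 => /eq_col_mx[/eqP].
rewrite mulNmx oppr_eq0 => /eqP-> /matrixP/(_ 0 0); rewrite !mxE mulr1.
by move=> E; split=> //; apply/eqP; rewrite -addr_eq0 -E dotpE mxE.
Qed.

Lemma slack_dotp (R : realType) (m n : nat) (A : 'M[R]_(m, n)) c y g :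
  A *m g = 0 -> dotp (c - A^T *m y) g = dotp c g.
Proof.
by move=> Ag; rewrite dotpDl dotpNl dotp_mulmxl trmxK Ag dotp0 subr0.
Qed.

(** Non-orthogonality is stated for [d] on [C], not for the whole direction, so that the cut is felt
    in a non-polyhedral block. *)
Lemma reducing_or_interior_slack (R : realType) (m n p : nat)
    (A : 'M[R]_(m, n)) (c : 'cV[R]_n) (C : set 'cV[R]_n) (B : 'M[R]_(p, n)) :
  conic C ->
  (exists s, [/\ qri C s, forall k, 0 <= (B *m s) k 0 &
                 exists y, s = c - A^T *m y]) \/
  exists (d : 'cV[R]_n) (l : 'cV[R]_p),
    [/\ dual_cone C d, forall k, 0 <= l k 0, A *m (d + B^T *m l) = 0 &
      dotp c (d + B^T *m l) < 0 \/
      dotp c (d + B^T *m l) = 0 /\ ~ orth C d].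
Proof.
move=> cC.
have [|noS] := pselect (exists s, [/\ qri C s, forall k, 0 <= (B *m s) k 0 &
                 exists y, s = c - A^T *m y]); first by left.
right; have [|d [l [sg [dC l0 sg0 E nz]]]] :=
  @partially_polyhedral_alternative R _ _ _ C (slack_mx A c)
    (B *m slack_mx A c) (level R m) cC.
  move=> [z [uz Bz riz]]; apply: noS.
  have [y Tz] := slack_mx_level A c uz.
  have sE : c - A^T *m y = (dotp (level R m) z)^-1 *: (slack_mx A c *m z).
    by rewrite Tz scalerA mulVf ?gt_eqF// scale1r.
  exists (c - A^T *m y); split; last by exists y.
    by rewrite sE; apply: qriZ; rewrite ?invr_gt0.
  by move=> k; rewrite sE -scalemxAr mulmxA mxE mulr_ge0// invr_ge0 ltW.
have [Ag cg] : A *m (d + B^T *m l) = 0 /\ dotp c (d + B^T *m l) = - sg.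
  by apply: slack_mx_tr; rewrite mulmxDr mulmxA -trmx_mul.
exists d, l; split=> //; rewrite cg.
have [sgp|] := ltP 0 sg; first by left; rewrite oppr_lt0.
move=> sgn; have sgE : sg = 0 by apply/eqP; rewrite eq_le sgn.
by right; case: nz; rewrite sgE ?ltxx ?oppr0.
Qed.

(** Duality for the objective given by row [k], which is zero on all the slacks. The multiplier
    terms added to that row are nonnegative on the face, so [g] dominates the row there. *)
Lemma slack_certificate (R : realType) (m n p : nat)
    (A : 'M[R]_(m, n)) (c : 'cV[R]_n) (C : set 'cV[R]_n) (B : 'M[R]_(p, n))
    (k : 'I_p) :
  conic C ->
  (exists s, [/\ qri C s, forall j, 0 <= (B *m s) j 0 &
                 exists y, s = c - A^T *m y]) ->
  (forall s, C s -> (forall j, 0 <= (B *m s) j 0) ->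
     (exists y, s = c - A^T *m y) -> (B *m s) k 0 = 0) ->
  exists g, [/\ A *m g = 0, dotp c g <= 0 &
    forall x, C x -> (forall j, 0 <= (B *m x) j 0) ->
      (B *m x) k 0 <= dotp g x].
Proof.
move=> cC [s0 [ris0 Bs0 [y0 s0E]]] Bk0; have [_ CZ _] := cC.
have [||d [l [sg [dC l0 sg0 E]]]] :=
  @partially_polyhedral_duality R _ _ _ C (slack_mx A c)
    (B *m slack_mx A c) (level R m) ((slack_mx A c)^T *m (row k B)^T) cC.
- exists (col_mx y0 1%:M); rewrite level_affine ltr01 -mulmxA slack_mx_affine.
  by rewrite -s0E.
- move=> z uz Bz Cz; have [y Tz] := slack_mx_level A c uz.
  have sE : c - A^T *m y = (dotp (level R m) z)^-1 *: (slack_mx A c *m z).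
    by rewrite Tz scalerA mulVf ?gt_eqF// scale1r.
  rewrite dotp_mulmxl trmxK dotp_row Tz -scalemxAr mxE Bk0 ?mulr0//.
  + by rewrite sE; apply: CZ => //; rewrite invr_ge0 ltW.
  + by move=> j; rewrite sE -scalemxAr mulmxA mxE mulr_ge0// invr_ge0 ltW.
  + by exists y.
have [Ag cg] : A *m (d + B^T *m l + (row k B)^T) = 0 /\
               dotp c (d + B^T *m l + (row k B)^T) = - sg.
  by apply: slack_mx_tr; rewrite !mulmxDr mulmxA -trmx_mul addrAC.
exists (d + B^T *m l + (row k B)^T); split=> //; first by rewrite cg oppr_le0.
move=> x Cx Bx; rewrite !dotpDl dotp_row lerDr addr_ge0//; first exact: dC.
by rewrite dotp_mulmxl trmxK dotp_ge0.
Qed.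

Section interior_slack.
Variables (R : realType) (m n p : nat) (A : 'M[R]_(m, n)) (c : 'cV[R]_n).
Variables (C : set 'cV[R]_n) (B : 'M[R]_(p, n)).
Hypothesis cC : conic C.

Let F : set 'cV[R]_n := C `&` [set x | forall k, 0 <= (B *m x) k 0].

Lemma conic_halfspaces : conic F.
Proof.
have [C0 CZ CD] := cC; split.
- by split=> // k; rewrite mulmx0 mxE.
- move=> a x a0 [Cx Bx]; split=> [|k]; first exact: CZ.
  by rewrite -scalemxAr mxE mulr_ge0.
- move=> x y [Cx Bx] [Cy By]; split=> [|k]; first exact: CD.
  by rewrite mulmxDr mxE addr_ge0.
Qed.

(** Averaging with a slack that is strict at [k] preserves the strict inequalities already obtained
    and relative interiority. *)
Lemma strict_slack (s0 : 'cV[R]_n) : qri C s0 -> slacks F A c s0 ->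
  exists s, [/\ qri C s, slacks F A c s & forall k,
    (exists2 s', slacks F A c s' & (B *m s') k 0 != 0) -> 0 < (B *m s) k 0].
Proof.
move=> ris0 Ss0.
suff H (ks : seq 'I_p) : exists s, [/\ qri C s, slacks F A c s &
    forall k, k \in ks ->
    (exists2 s', slacks F A c s' & (B *m s') k 0 != 0) -> 0 < (B *m s) k 0].
  have [s [? ? sP]] := H (enum 'I_p).
  by exists s; split=> // k; apply: sP; rewrite mem_enum.
elim: ks => [|k ks [s [ris Ss sP]]]; first by exists s0.
have [[s' Ss' s'k]|nok] :=
  pselect (exists2 s', slacks F A c s' & (B *m s') k 0 != 0); last first.
  by exists s; split=> // j; rewrite inE => /orP[/eqP->//|]; exact: sP.
have [[Cs Bs] [y sE]] := Ss; have [[Cs' Bs'] [y' s'E]] := Ss'.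
have half0 : 0 < 2^-1 :> R by rewrite invr_gt0.
have ris2 : qri C (2^-1 *: (s + s')) by apply: qriZ => //; exact: qriD.
have BE j : (B *m (2^-1 *: (s + s'))) j 0 =
            2^-1 * ((B *m s) j 0 + (B *m s') j 0).
  by rewrite -scalemxAr mulmxDr mxE [X in _ * X]mxE.
exists (2^-1 *: (s + s')); split=> //.
  split.
    by split=> [|j]; [case: ris2|rewrite BE mulr_ge0 ?addr_ge0// ltW].
  exists (2^-1 *: (y + y')); rewrite s'E sE -scalemxAr mulmxDr addrACA -opprD.
  rewrite scalerBr; congr (_ - _); rewrite -mulr2n -[c *+ 2]scaler_nat.
  by rewrite scalerA mulVf ?scale1r.
move=> j; rewrite inE BE pmulr_rgt0// => /orP[/eqP-> _|/sP/[apply] sj].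
  by apply: ltr_wpDl => //; rewrite lt_neqAle eq_sym s'k Bs'.
by apply: ltr_pwDl.
Qed.

Lemma slack_prolongation (s x : 'cV[R]_n) : qri C s -> F s -> F x ->
  (forall k, 0 < (B *m s) k 0 \/ (B *m x) k 0 = 0) ->
  exists2 e : R, 0 < e < 1 & F (s - e *: x).
Proof.
move=> ris [Cs Bs] [Cx Bx] sx; have [_ CZ CD] := cC.
suff H (ks : seq 'I_p) : exists2 e : R, 0 < e < 1 & C (s - e *: x) /\
    forall k, k \in ks -> 0 <= (B *m (s - e *: x)) k 0.
  have [e e01 [Ce Be]] := H (enum 'I_p).
  by exists e => //; split=> // k; apply: Be; rewrite mem_enum.
have shrink e e' : e' <= e -> C (s - e *: x) -> C (s - e' *: x).
  move=> ee Ce; have -> : s - e' *: x = s - e *: x + (e - e') *: x.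
    by rewrite scalerBl addrA subrK.
  by apply: (CD) => //; apply: CZ; rewrite ?subr_ge0.
have BE e k : (B *m (s - e *: x)) k 0 = (B *m s) k 0 - e * (B *m x) k 0.
  by rewrite mulmxBr -scalemxAr mxE [X in _ + X]mxE [X in _ - X]mxE.
elim: ks => [|k ks [e /andP[e0 e1] [Ce Be]]].
  have [e e0 Ce] := qri_prolongation cC ris Cx.
  exists (Num.min e 2^-1); last first.
    by split=> //; apply: shrink Ce; rewrite ge_min lexx.
  by rewrite lt_min e0 invr_gt0 ltr0n/= gt_min invf_lt1 ?ltr1n ?orbT.
have [sk|xk] := sx k; last first.
  exists e; first by rewrite e0.
  split=> // j; rewrite inE => /orP[/eqP->|]; last exact: Be.
  by rewrite BE xk mulr0 subr0.
have x1 : 0 < (B *m x) k 0 + 1 by rewrite ltr_wpDl.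
(* Adding 1 to the denominator keeps it positive even when [x] is tight at [k]. *)
exists (Num.min e ((B *m s) k 0 / ((B *m x) k 0 + 1))).
  by rewrite lt_min e0 divr_gt0//= gt_min e1.
split; first by apply: shrink Ce; rewrite ge_min lexx.
move=> j; rewrite inE BE subr_ge0 => /orP[/eqP->|/Be].
  apply: (@le_trans _ _ ((B *m s) k 0 / ((B *m x) k 0 + 1) * (B *m x) k 0)).
    by rewrite ler_wpM2r// ge_min lexx orbT.
  rewrite mulrAC ler_pdivrMr//; rewrite ler_wpM2l//; lra.
rewrite BE subr_ge0; apply: le_trans.
by rewrite ler_wpM2r// ge_min lexx.
Qed.

Lemma facial_reduction_interior_slack (s0 : 'cV[R]_n) :
  qri C s0 -> slacks F A c s0 ->
  exists2 ds, facial_reduction A c F ds (min_face F (slacks F A c)) &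
    (size ds <= 1)%N.
Proof.
move=> ris0 Ss0; have cF := conic_halfspaces.
have [s1 [ris1 Ss1 s1P]] := strict_slack ris0 Ss0.
have [Fs1 [y1 s1E]] := Ss1.
pose bad k := `[< forall s, slacks F A c s -> (B *m s) k 0 = 0 >].
have /choice[g gP] : forall k, exists g, bad k ->
    [/\ A *m g = 0, dotp c g <= 0 & forall x, F x -> (B *m x) k 0 <= dotp g x].
  move=> k; have [/asboolP bk|_] := boolP (bad k); last by exists 0.
  have [||g [Ag cg gB]] := @slack_certificate R _ _ _ A c C B k cC.
  - by have [[_ Bs0] y0] := Ss0; exists s0.
  - by move=> s Cs Bs ys; apply: bk; split.
  - by exists g => _; split=> // x [Cx Bx]; exact: gB.
pose h := \sum_(k | bad k) g k.
have gF k x : bad k -> F x -> (B *m x) k 0 <= dotp (g k) x.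
  by move=> /gP[_ _ gB] /gB.
have gF0 k x : bad k -> F x -> 0 <= dotp (g k) x.
  by move=> bk Fx; apply: le_trans (gF _ _ bk Fx); case: Fx.
have hF : dual_cone F h.
  by move=> x Fx; rewrite dotp_suml sumr_ge0// => k bk; exact: gF0.
have Ah : A *m h = 0 by rewrite mulmx_sumr big1// => k /gP[].
(* The certificates give one inequality. The other holds because the slack [s1] is in [F] and pairs
   with [h] as [c] does. *)
have ch : dotp c h = 0.
  apply/eqP; rewrite eq_le; apply/andP; split.
    by rewrite dotpC dotp_suml sumr_le0// => k /gP[_ cg _]; rewrite dotpC.
  by rewrite -(slack_dotp c y1 Ah) -s1E dotpC; exact: hF.
have SH : slacks F A c `<=` F `&` orth [set h].
  by move=> s [Fs [y sE]]; split=> // _ ->; rewrite sE slack_dotp.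
have prol x : F x -> dotp h x = 0 -> exists2 e : R, 0 < e < 1 & F (s1 - e *: x).
  move=> Fx; rewrite dotp_suml => /psumr_eq0P E.
  apply: slack_prolongation => // k.
  have [bk|/asboolPn/existsNP[s /not_implyP[Ss /eqP sk]]] := boolP (bad k).
    right; apply/eqP; rewrite eq_le; have [_ ->] := Fx; rewrite andbT.
    by rewrite -(E _ k bk) ?gF// => j bj; exact: gF0.
  by left; apply: s1P; exists s.
(* By [prol], [s1] is a proper convex combination of any [x] of the exposed face and a point of [F],
   so each face containing the slacks contains [x]. *)
have FE : F `&` orth [set h] = min_face F (slacks F A c).
  apply/seteqP; split=> x; last first.
    by apply; split=> //; exact: exposed_face.
  move=> [Fx xh] G [[cG GF Ge] SG].
  have [|e /andP[e0 e1] Fe] := prol x Fx; first by rewrite dotpC xh.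
  have e1' : 0 < 1 - e by rewrite subr_gt0.
  have Fe' : F ((1 - e)^-1 *: (s1 - e *: x)).
    by have [_ FZ _] := cF; apply: FZ; rewrite // invr_ge0 ltW.
  have [] // := Ge x _ e Fx Fe'; first by rewrite e0.
  by rewrite scalerA mulfV ?gt_eqF// scale1r addrC subrK; exact: SG.
(* A candidate [d] is nonnegative at the slack [s1], so it is not negative on [c]; if it vanishes at
   [s1], prolongation beyond [s1] makes it vanish on the whole face. *)
have stop : ~ exists d, reducing_direction A c (F `&` orth [set h]) d.
  move=> [d [dH Ad]]; rewrite -(slack_dotp c y1 Ad) -s1E dotpC.
  have ds1 : 0 <= dotp d s1 by apply: dH; exact: SH.
  move=> [[ndH d0]|]; last by rewrite ltNge ds1.
  apply: ndH => x Hx; have [Fx xh] := Hx; have xh0 := xh h erefl.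
  have [|e /andP[e0 e1] Fe] := prol x Fx; first by rewrite dotpC.
  have := dH _ Hx.
  have : 0 <= dotp d (s1 - e *: x).
    apply: dH; split=> // _ ->; rewrite dotpDl dotpNl dotpZl xh0.
    have [_ /(_ h erefl) ->] := SH _ Ss1.
    by rewrite mulr0 subr0.
  by rewrite dotpDr dotpNr dotpZr d0; nra.
(* If [h] vanishes on [F], it is not a reducing direction, but then [F] is already the minimal face
   and the run stops at once. *)
have [oh|noh] := pselect (orth F h).
  exists [::] => //; rewrite -FE (_ : F `&` _ = F); first last.
    apply/seteqP; split=> [x []//|x Fx]; split=> // _ ->.
    by rewrite dotpC; exact: oh.
  apply: FR_stop; rewrite (_ : F = F `&` orth [set h])//.
  apply/seteqP; split=> [x Fx|x []//]; split=> // _ ->.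
  by rewrite dotpC; exact: oh.
exists [:: h] => //; rewrite -FE; apply: FR_step => //; last exact: FR_stop.
by split=> //; left.
Qed.

End interior_slack.

Definition nonpolyhedral_part (R : realType) (r : nat) (n : 'I_r -> nat)
    (F : forall i, set 'cV[R]_(n i)) : set 'cV[R]_(\sum_(i < r) n i) :=
  [set x | forall i, ~ polyhedral (F i) -> F i (submxcol x i)].

Lemma conic_nonpolyhedral_part (R : realType) (r : nat) (n : 'I_r -> nat)
    (F : forall i, set 'cV[R]_(n i)) :
  (forall i, conic (F i)) -> conic (nonpolyhedral_part F).
Proof.
move=> cF; split.
- by move=> i _; rewrite submxcol0; have [] := cF i.
- move=> a x a0 Cx i /Cx; have [_ FZ _] := cF i.
  rewrite (_ : submxcol (a *: x) i = a *: submxcol x i); first exact: FZ.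
  by apply/matrixP => j k; rewrite !mxE.
- move=> x y Cx Cy i ni; have [_ _ FD] := cF i.
  by rewrite submxcolD; apply: FD; [exact: Cx|exact: Cy].
Qed.

Lemma polyhedral_part_halfspaces (R : realType) (r : nat) (n : 'I_r -> nat)
    (F : forall i, set 'cV[R]_(n i)) :
  (forall i, conic (F i)) ->
  exists (p : nat) (B : 'M[R]_(p, \sum_(i < r) n i)), forall x,
    (forall k, 0 <= (B *m x) k 0) <->
    (forall i, polyhedral (F i) -> F i (submxcol x i)).
Proof.
move=> cF; have H i : exists B : {k & 'M[R]_(k, n i)}, forall x,
    (forall j, 0 <= (projT2 B *m x) j 0) <-> (polyhedral (F i) -> F i x).
  have [/[dup] pF /(polyhedral_cone (cF i))[k [B BP]]|nF] :=
    pselect (polyhedral (F i)).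
    by exists (existT _ k B) => x; rewrite /= -BP; split; auto.
  (* A non-polyhedral block contributes no inequality. *)
  by exists (existT _ 0%N (0 : 'M[R]_(0, n i))) => x; split=> // _ [].
pose B i := sval (cid (H i)).
pose I : 'M[R]_(\sum_(i < r) n i) := 1%:M.
exists _, (\mxcol_i (projT2 (B i) *m submxcol I i)) => x.
have BE i : projT2 (B i) *m submxcol I i *m x = projT2 (B i) *m submxcol x i.
  by rewrite -mulmxA submxcol_mul mul1mx.
rewrite mxcol_mul; under eq_mxcol do rewrite BE.
split=> [Bx i|Fx k].
  apply/(svalP (cid (H i))) => j.
  have := Bx (tagnat.Rank i j).
  have /matrixP/(_ j 0) := mxcolK (fun i => projT2 (B i) *m submxcol x i) i.
  by rewrite mxE => ->.
rewrite mxE; move: (tagnat.sig1 k) (tagnat.sig2 k) => i.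
by apply/(svalP (cid (H i)))/Fx.
Qed.

(** Zeroing the polyhedral blocks of a point of [C] does not change its pairing with [d], since [C]
    is unconstrained there, and makes [B^T *m l] vanish. The direction is therefore nonzero on some
    non-polyhedral block of that point. *)
Lemma nonpolyhedral_block_cut (R : realType) (r : nat) (n : 'I_r -> nat)
    (F : forall i, set 'cV[R]_(n i)) (p : nat)
    (B : 'M[R]_(p, \sum_(i < r) n i)) d (l : 'cV[R]_p) :
  (forall i, F i 0) ->
  (forall x, (forall k, 0 <= (B *m x) k 0) <->
     (forall i, polyhedral (F i) -> F i (submxcol x i))) ->
  dual_cone (nonpolyhedral_part F) d -> (forall k, 0 <= l k 0) ->
  ~ orth (nonpolyhedral_part F) d ->
  exists i, ~ polyhedral (F i) /\
    ~ F i `<=` orth [set submxcol (d + B^T *m l) i].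
Proof.
move=> F0 BP dC l0 /existsNP[x /not_implyP[Cx dx]].
pose x' := \mxcol_i (if `[< polyhedral (F i) >] then 0 else submxcol x i).
have x'E i : submxcol x' i =
    if `[< polyhedral (F i) >] then 0 else submxcol x i by rewrite mxcolK.
have dx' : dotp d x' = dotp d x.
  have Cx1 : nonpolyhedral_part F (x - x').
    by move=> i ni; rewrite submxcolB x'E asboolF// subrr.
  have Cx2 : nonpolyhedral_part F (x' - x).
    by move=> i ni; rewrite submxcolB x'E asboolF// subrr.
  by have := dC _ Cx1; have := dC _ Cx2; rewrite !dotpDr !dotpNr; lra.
have Bx' : dotp (B^T *m l) x' = 0.
  have Bl1 : 0 <= dotp l (B *m x').
    by apply: dotp_ge0 => //; apply/BP => i pi; rewrite x'E asboolT.
  have Bl2 : 0 <= dotp l (B *m - x').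
    apply: dotp_ge0 => //; apply/BP => i pi.
    by rewrite submxcolN x'E asboolT// oppr0.
  by rewrite mulmxN dotpNr in Bl2; rewrite dotp_mulmxl trmxK; lra.
apply: contrapT => noi; apply: dx; rewrite -dx' -[LHS]addr0 -Bx' -dotpDl.
rewrite dotp_blocks big1// => i _; rewrite x'E; case: asboolP => [_|ni].
  by rewrite dotp0.
rewrite dotpC; have [ort|nort] :=
  pselect (F i `<=` orth [set submxcol (d + B^T *m l) i]).
  by apply: ort => //; exact: Cx.
by case: noi; exists i.
Qed.

Lemma facial_reduction_prod_cone (R : realType) (m r : nat) (n : 'I_r -> nat)
    (A : 'M[R]_(m, \sum_(i < r) n i)) (c : 'cV[R]_(\sum_(i < r) n i))
    (F : forall i, set 'cV[R]_(n i)) :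
  (forall i, closed_convex_cone (F i)) ->
  exists ds, facial_reduction A c (prod_cone F) ds
      (min_face (prod_cone F) (slacks (prod_cone F) A c)) /\
    (size ds <= 1 + \sum_(i < r) lpoly (F i))%N.
Proof.
have [k] := ubnP (\sum_(i < r) lpoly (F i))%N.
elim: k F => // k IH F; rewrite ltnS => lek ccF.
have cF i := closed_convex_cone_conic (ccF i).
have F0 i : F i 0 by have [] := cF i.
have [p [B BP]] := polyhedral_part_halfspaces cF.
have cC := conic_nonpolyhedral_part cF.
set C := nonpolyhedral_part F in cC.
have FE : prod_cone F = C `&` [set x | forall k, 0 <= (B *m x) k 0].
  apply/seteqP; split=> x.
    by move=> Fx; split=> [i _|]; [exact: Fx|apply/BP => i _; exact: Fx].
  move=> [Cx /BP Bx] i.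
  by have [/Bx|/Cx] := pselect (polyhedral (F i)).
have [[s [ris Bs ys]]|[d [l [dC l0 Ag cg]]]] :=
    reducing_or_interior_slack A c B cC.
  have Ss : slacks (prod_cone F) A c s.
    by split=> //; rewrite FE; split=> //; case: ris.
  rewrite FE in Ss *.
  have [ds run sds] := facial_reduction_interior_slack cC ris Ss.
  by exists ds; split=> //; exact: leq_trans sds (leq_addr _ _).
set g := d + B^T *m l in Ag cg.
have gF : dual_cone (prod_cone F) g.
  rewrite FE => x [Cx Bx]; rewrite dotpDl addr_ge0//; first exact: dC.
  by rewrite dotp_mulmxl trmxK dotp_ge0.
have [cg0|[cg0 nC]] := cg.
  (* Slacks pair with [g] as [c] does, so a direction negative on [c] excludes them all. *)
  have -> : slacks (prod_cone F) A c = set0.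
    apply/seteqP; split=> // s [Fs [y sE]].
    have := gF _ Fs; rewrite dotpC sE slack_dotp//.
    by rewrite leNgt cg0.
  exists [:: g]; rewrite min_face0; split=> //.
  by apply: FR_infeasible => //; split=> //; right.
have [i [ni cut]] := nonpolyhedral_block_cut F0 BP dC l0 nC.
pose F' i := F i `&` orth [set submxcol g i].
have gi j : dual_cone (F j) (submxcol g j) by exact: dual_prod_cone.
have F'E : prod_cone F `&` orth [set g] = prod_cone F'.
  exact: prod_cone_exposed_face.
have ccF' j : closed_convex_cone (F' j).
  exact: exposed_face_closed_convex_cone.
have fF' j : face (F j) (F' j) by exact: exposed_face.
have SE : slacks (prod_cone F') A c = slacks (prod_cone F) A c.
  rewrite -F'E; apply/seteqP; split=> s; first by move=> [[Fs _] ys].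
  move=> [Fs [y sE]]; split; last by exists y.
  by split=> // _ ->; rewrite sE slack_dotp.
(* The cut block [i] loses at least one, and no other block increases; this pays for the direction
   [g]. *)
have lt : (\sum_(i < r) lpoly (F' i) < \sum_(i < r) lpoly (F i))%N.
  rewrite (bigD1 i)//= [X in (_ < X)%N](bigD1 i)//= -addSn leq_add//.
    by apply: lpoly_proper_face => // FF'; apply: cut => x /FF'[].
  by apply: leq_sum => j _; exact: lpoly_face.
have [ds [run sds]] := IH _ (leq_trans lt lek) ccF'.
exists (g :: ds); split; last by rewrite /= add1n ltnS (leq_trans sds).
apply: FR_step => //.
- split=> //; left; split=> // og; apply: cut => x Fx _ ->.
  (* Testing [g] on vectors supported in block [i] shows that it does not vanish on the product. *)
  have [y [yi yj]] := block_vector x.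
  have := og y; rewrite dotp_blocks (bigD1 i)//= yi big1 => [|j /yj ->].
    rewrite addr0 dotpC; apply => j.
    by have [->|/yj ->//] := eqVneq j i; rewrite yi.
  by rewrite dotp0.
- rewrite F'E -(min_face_of_face (H := prod_cone F')) -?SE//.
    rewrite -F'E; apply: exposed_face => //.
    by rewrite FE; exact: conic_halfspaces.
  by move=> s [].
Qed.

Theorem theorem10 (R : realType) (m r : nat) (n : 'I_r -> nat)
    (K : forall i : 'I_r, set 'cV[R]_(n i))
    (A : 'M[R]_(m, \sum_(i < r) n i)) (b : 'cV[R]_m)
    (c : 'cV[R]_(\sum_(i < r) n i)) :
  (forall i, closed_convex_cone (K i)) ->
  exists ds : seq 'cV[R]_(\sum_(i < r) n i),
    facial_reduction A c (prod_cone K) ds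
      (min_face (prod_cone K) (slacks (prod_cone K) A c)) /\
    (size ds <= 1 + \sum_(i < r) lpoly (K i))%N.
Proof. exact: facial_reduction_prod_cone. Qed.
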